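(* Let $a,b,c\in\mathbb{R}$, $1\le p<\infty$, $0<q,r<\infty$. (i) If $\frac{a+N}{q}\ne\frac{b-p+N}{p}$ and $W^{1,(q,p)}_{\{a,b\}}(\mathbb{R}^N_* )$ is continuously embedded into $L^r(\mathbb{R}^N;|x|^cdx)$, then $\theta_c\in[0,1]$ and $\theta_c\left(\frac1p-\frac1N-\frac1q\right)\le\frac1r-\frac1q$. In particular $r\le\max\{p^*,q\}$. (ii) If $\frac{a+N}{q}=\frac{b-p+N}{p}$, $c=c^0$, and $W^{1,(q,p)}_{\{a,b\}}(\mathbb{R}^N_* )$ is continuously embedded into $L^r(\mathbb{R}^N;|x|^cdx)$, then $r\le\max\{p^*,q\}$.
   Context: $N\ge1$, $\mathbb{R}^N_*:=\mathbb{R}^N\setminus\{0\}$. For $d\in\mathbb{R}$, $0<s<\infty$, $\|u\|_{d,s}:=(\int_{\mathbb{R}^N}|x|^d|u|^s dx)^{1/s}$ ($\{0\}$ of measure $0$; Euclidean norm for vector-valued $u$), $L^s(\mathbb{R}^N;|x|^ddx)$ the measurable $u$ with $\|u\|_{d,s}<\infty$. $W^{1,(q,p)}_{\{a,b\}}(\mathbb{R}^N_* )$: $u\in L^1_{loc}(\mathbb{R}^N_* )$ with $\|u\|_{a,q},\|\nabla u\|_{b,p}<\infty$ (distributional gradient on $\mathbb{R}^N_*$), (quasi-)norm $\|u\|_{a,q}+\|\nabla u\|_{b,p}$. $p^*:=\infty$ if $p\ge N$, $p^*:=Np/(N-p)$ if $p<N$. $c^0:=\frac{r(a+N)}{q}-N$,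 $c^1:=\frac{r(b-p+N)}{p}-N$, $\theta_c:=\frac{c-c^0}{c^1-c^0}$ when $c^0\neq c^1$. *)

(* Defs.v *)
From HB Require Import structures.
From mathcomp Require Import all_boot all_order all_algebra.
From mathcomp Require Import all_classical all_reals all_analysis.
Set Implicit Arguments. Unset Strict Implicit. Unset Printing Implicit Defensive.
Import Order.TTheory GRing.Theory Num.Theory.
Import numFieldNormedType.Exports.
Local Open Scope classical_set_scope.
Local Open Scope ring_scope.

Section Defs.
Variable R : realType.

(* Euclidean norm on R^N (the library's norm on 'rV is the sup norm). *)
Definition enorm (N : nat) (x : 'rV[R]_N) : R :=
  Num.sqrt (\sum_(i < N) x ord0 i ^+ 2).

Definition row_of_seq (N : nat) (s : seq R) : 'rV[R]_N := \row_(i < N) nth 0 s i.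

(* iterated Lebesgue integral over R^n (Tonelli: for nonnegative Borel
   functions this is the Lebesgue integral over R^n) *)
Fixpoint iint (n : nat) (g : seq R -> \bar R) : \bar R :=
  match n with
  | 0 => g [::]
  | n'.+1 => (\int[@lebesgue_measure R]_t iint n' (fun s => g (t :: s)))%E
  end.

Definition integralN (N : nat) (f : 'rV[R]_N -> \bar R) : \bar R :=
  iint N (fun s => f (row_of_seq N s)).

Definition sintegralN (N : nat) (f : 'rV[R]_N -> R) : \bar R :=
  (integralN (fun x => (Num.max (f x) 0)%:E)
   - integralN (fun x => (Num.max (- f x) 0)%:E))%E.

Definition borel_fun (N : nat) (f : 'rV[R]_N -> R) : Prop :=
  forall B : set R, measurable B -> <<s (@open 'rV[R]_N) >> (f @^-1` B).

Definition wint (N : nat) (d s : R) (nf : 'rV[R]_N -> R) : \bar R :=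
  integralN (fun x => ((enorm x) `^ d * (nf x) `^ s)%:E).

Definition wnorm (N : nat) (d s : R) (u : 'rV[R]_N -> R) : \bar R :=
  poweR (wint d s (fun x => `|u x|)) s^-1.

Definition wnormv (N : nat) (d s : R) (g : 'rV[R]_N -> 'rV[R]_N) : \bar R :=
  poweR (wint d s (fun x => enorm (g x))) s^-1.

Definition L1loc (N : nat) (u : 'rV[R]_N -> R) : Prop :=
  borel_fun u /\
  forall eps rho : R, 0 < eps -> eps < rho ->
    (integralN (fun x => ((if (eps <= enorm x <= rho) then 1 else 0) * `|u x|)%:E)
       < +oo)%E.

Definition ebasis (N : nat) (i : 'I_N) : 'rV[R]_N := delta_mx 0 i.

Definition Dpart (N : nat) (l : seq 'I_N) (f : 'rV[R]_N -> R^o) : 'rV[R]_N -> R^o :=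
  foldr (fun i g => 'D_(ebasis i) g) f l.

Definition test_fun (N : nat) (phi : 'rV[R]_N -> R^o) : Prop :=
  (forall l : seq 'I_N, continuous (Dpart l phi) /\
     forall (i : 'I_N) (x : 'rV[R]_N), derivable (Dpart l phi) x (ebasis i)) /\
  exists eps rho : R, 0 < eps /\ eps < rho /\
    forall x, (enorm x < eps \/ rho < enorm x) -> phi x = 0.

Definition weak_grad (N : nat) (u : 'rV[R]_N -> R) (g : 'rV[R]_N -> 'rV[R]_N) : Prop :=
  L1loc u /\ (forall i : 'I_N, L1loc (fun x => g x ord0 i)) /\
  forall phi, test_fun phi -> forall i : 'I_N,
    sintegralN (fun x => u x * Dpart [:: i] phi x)
    = (- sintegralN (fun x => (g x ord0 i * phi x)%R))%E.

Definition inW (N : nat) (a b q p : R) (u : 'rV[R]_N -> R) (g : 'rV[R]_N -> 'rV[R]_N) : Prop :=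
  weak_grad u g /\ (wnorm a q u < +oo)%E /\ (wnormv b p g < +oo)%E.

Definition cont_embedded (N : nat) (a b q p c r : R) : Prop :=
  exists C : R, forall u g, @inW N a b q p u g ->
    (wnorm c r u <= C%:E * (wnorm a q u + wnormv b p g))%E.

Definition c0 (N : nat) (a q r : R) : R := r * (a + N%:R) / q - N%:R.
Definition c1 (N : nat) (b p r : R) : R := r * (b - p + N%:R) / p - N%:R.
Definition theta (N : nat) (a b q p r c : R) : R :=
  (c - c0 N a q r) / (c1 N b p r - c0 N a q r).

(* r <= max{p^*, q}, with p^* = infinity if p >= N *)
Definition r_le_max_pstar_q (N : nat) (p q r : R) : Prop :=
  p < N%:R -> r <= Num.max (N%:R * p / (N%:R - p)) q.

End Defs.

(* Main.v *)
(* The embedding inequality is tested on products of one-dimensional bumps of width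
   rho = exp(sigma) in each coordinate, centred at (m, ..., m) with m = exp(tau) and
   rho <= m / e. There the weight |x|^d is comparable to m^d, so the three norms have the
   sizes (m^c rho^N)^(1/r), (m^a rho^N)^(1/q) and (m^b rho^(N-p))^(1/p). Letting
   (tau, sigma) tend to infinity along a ray (alpha, beta), beta <= alpha, gives a linear
   inequality between the exponents: the rays (1,1) and (-1,-1) give 0 <= theta <= 1,
   the ray (0,-1) gives r <= max(p^*, q), and the ray (t, t-1) along which the two norms
   on the right balance gives the remaining inequality.

   That the classical gradient of the bump u is its weak gradient amounts to
   int d_i (u phi) = 0. It is proved without Fubini: iterated integrals are invariant under
   translation in one coordinate, and difference quotients converge uniformly. *)

Require Import Defs.
From HB Require Import structures.
From mathcomp Require Import all_boot all_order all_algebra.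
From mathcomp Require Import all_classical all_reals all_analysis.
From mathcomp Require Import measurable_realfun ring lra.
Import Order.TTheory GRing.Theory Num.Theory.
Import numFieldNormedType.Exports.
Local Open Scope classical_set_scope.
Local Open Scope ring_scope.

(** * One-dimensional integrals: monotonicity, compact support, translation *)

Section OneDim.
Context {R : realType}.
Notation mu := (@lebesgue_measure R).

(** The integral of a nonnegative function is a supremum over the simple functions below it, and
    that family grows with the function. Measurability does not enter, so slices of iterated
    integrals can be compared directly. *)
Lemma ge0_integral_mono d (T : measurableType d) (m : {measure set T -> \bar R})
    (f g : T -> \bar R) :
  (forall x, (0 <= f x)%E) -> (forall x, (f x <= g x)%E) ->
  (\int[m]_x f x <= \int[m]_x g x)%E.
Proof.
move=> f0 fg; have g0 x : (0 <= g x)%E by exact: le_trans (fg x).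
rewrite !ge0_integralTE//; apply: le_ereal_sup => _ [h hf <-].
by exists h => // x; exact: le_trans (fg x).
Qed.

Lemma integral_cst_itv (k x y : R) : 0 <= k -> x <= y ->
  (\int[mu]_t (k * \1_`[x, y] t)%:E = (k * (y - x))%:E)%E.
Proof.
move=> k0 xy.
under eq_integral do rewrite EFinM.
rewrite ge0_integralZl//; last by apply/measurable_EFinP; exact: measurable_indic.
rewrite integral_indic// setIT EFinM; congr (_ * _)%E.
transitivity (lebesgue_measure [set` `[x, y]]) => //.
by rewrite lebesgue_measure_itv/= lte_fin; case: ltgtP xy => // -> _; rewrite subrr.
Qed.

Lemma integrable_compact_support (M : R) (f : R -> R) : continuous f ->
  (forall t, M < `|t| -> f t = 0) -> mu.-integrable setT (EFin \o f).
Proof.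
move=> fc f0.
have fE : (EFin \o f) \_ (`[- M, M]) = EFin \o f.
  apply/funext => t; rewrite /patch; case: ifPn => // tM /=.
  rewrite f0// ltNge; apply: contra tM => tM; apply/mem_set.
  by rewrite /= in_itv/= -ler_norml.
rewrite -fE.
have := proj1 (integrable_mkcond (mu := mu) (EFin \o f) (measurable_itv `[- M, M])).
apply.
apply: continuous_compact_integrable; first exact: segment_compact.
exact: continuous_subspaceT.
Qed.

Lemma normr_Rintegral_le (M B : R) (f : R -> R) : 0 <= M -> continuous f ->
  (forall t, M < `|t| -> f t = 0) -> (forall t, `|f t| <= B) ->
  `|\int[mu]_t f t| <= B * (2 * M).
Proof.
move=> M0 fc f0 fB; have fi := integrable_compact_support M f fc f0.
have B0 : 0 <= B by apply: le_trans (fB 0).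
apply: le_trans (le_normr_Rintegral _ fi) _ => //.
rewrite -lee_fin fineK; last first.
  by apply: integrable_fin_num => //; apply: integrable_norm fi.
have -> : B * (2 * M) = B * (M - - M) by ring.
rewrite -integral_cst_itv//; last by lra.
apply: ge0_integral_mono => t; rewrite lee_fin//.
rewrite indicE; case: (boolP (t \in _)) => [_|tM]; first by rewrite mulr1.
rewrite mulr0 f0 ?normr0// ltNge; apply: contra tM => tM; apply/mem_set.
by rewrite /= in_itv/= -ler_norml.
Qed.

Lemma ge0_integral_translation (h : R) (f : R -> R) : continuous f ->
  (forall t, 0 <= f t) -> (\int[mu]_t (f (t + h))%:E = \int[mu]_t (f t)%:E)%E.
Proof.
move=> fc f0.
have dF (x : R) : is_derive x 1 (fun x : R => x + h) 1.
  by rewrite -[X in is_derive _ _ _ X]addr0; apply: is_deriveD.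
have F1 : ((fun x : R => x + h)^`())%classic = cst 1.
  by apply/funext => x; rewrite derive1E; apply: derive_val.
rewrite (@increasing_ge0_integration_by_substitutionT R (fun x => x + h) f)//.
- by rewrite F1; apply: eq_integral => t _; congr EFin; rewrite -[LHS]mulr1.
- by move=> x y; rewrite ltrD2r.
- by rewrite F1; apply: cst_continuous.
- by rewrite F1; apply: is_cvg_cst.
- by rewrite F1; apply: is_cvg_cst.
- apply/cvgrNyPle => A; near=> x; rewrite -lerBrDr.
  by near: x; apply: nbhs_ninfty_le; rewrite num_real.
- apply/cvgryPge => A; near=> x; rewrite -lerBlDr.
  by near: x; apply: nbhs_pinfty_ge; rewrite num_real.
Unshelve. all: by end_near. Qed.

Lemma Rintegral_translation (h : R) (f : R -> R) : continuous f ->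
  \int[mu]_t f (t + h) = \int[mu]_t f t.
Proof.
move=> fc; congr fine; rewrite integralE [RHS]integralE; congr (_ - _)%E.
- under eq_integral do rewrite funeposE -EFin_max.
  under [RHS]eq_integral do rewrite funeposE -EFin_max.
  apply: (@ge0_integral_translation h (fun t => Num.max (f t) 0)).
    by move=> t; apply: continuous_max => //; [exact: fc|exact: cvg_cst].
  by move=> t; rewrite le_max lexx orbT.
- under eq_integral do rewrite funenegE -EFinN -EFin_max.
  under [RHS]eq_integral do rewrite funenegE -EFinN -EFin_max.
  apply: (@ge0_integral_translation h (fun t => Num.max (- f t) 0)).
    move=> t; apply: (@continuous_max R R (- f) (cst 0)); last exact: cvg_cst.
    by apply: continuousN; exact: fc.
  by move=> t; rewrite le_max lexx orbT.
Qed.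

End OneDim.

(** * Iterated integrals of uniformly continuous functions with bounded support *)

Section IteratedIntegral.
Context {R : realType}.
Notation mu := (@lebesgue_measure R).
Implicit Types (n i : nat) (M c : R) (G H : seq R -> R).

(* Sequences stand for points of R^n; only the entries of index < n matter. *)
Definition unif_cont_supp n M G : Prop :=
  (forall s i, (i < n)%N -> M < `|nth 0 s i| -> G s = 0) /\
  (forall e, 0 < e -> exists2 d, 0 < d & forall s s',
    (forall i, (i < n)%N -> `|nth 0 s i - nth 0 s' i| <= d) ->
    `|G s - G s'| <= e).

(** Real-valued counterpart of [iint] for signed functions. Each layer passes through [fine], so the
    value is meaningful when every slice is integrable, which [unif_cont_supp] guarantees. *)
Fixpoint riint n G : R :=
  match n with
  | 0 => G [::]
  | n'.+1 => \int[mu]_t riint n' (fun s => G (t :: s))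
  end.

Lemma unif_cont_supp_cons n M G t : unif_cont_supp n.+1 M G ->
  unif_cont_supp n M (fun s => G (t :: s)).
Proof.
move=> [G0 Gc]; split=> [s i ilt sM|e e0]; first exact: (G0 _ i.+1).
have [d d0 Gd] := Gc e e0; exists d => // s s' ss'; apply: Gd => -[_|i] /=.
  by rewrite subrr normr0 ltW.
exact: ss'.
Qed.

Lemma unif_cont_supp_lin n M c G H : unif_cont_supp n M G ->
  unif_cont_supp n M H -> unif_cont_supp n M (fun s => c * G s + H s).
Proof.
move=> [G0 Gc] [H0 Hc]; split=> [s i ilt sM|e e0].
  by rewrite (G0 s i)// (H0 s i)// mulr0 addr0.
(* The summand [1] keeps the divisor positive when [c] is zero. *)
have c0 : 0 < `|c| + 1 by apply: ltr_wpDl.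
have [d1 d10 Gd] := Gc (e / 2 / (`|c| + 1)) ltac:(by rewrite !divr_gt0).
have [d2 d20 Hd] := Hc (e / 2) ltac:(by rewrite divr_gt0).
exists (Num.min d1 d2); first by rewrite lt_min d10.
move=> s s' ss'.
have {}Gd : `|G s - G s'| <= e / 2 / (`|c| + 1).
  by apply: Gd => i /ss'; rewrite le_min => /andP[].
have {}Hd : `|H s - H s'| <= e / 2.
  by apply: Hd => i /ss'; rewrite le_min => /andP[].
have -> : c * G s + H s - (c * G s' + H s') = c * (G s - G s') + (H s - H s').
  by ring.
apply: le_trans (ler_normD _ _) _; rewrite normrM (splitr e) lerD//.
have -> : e / 2 = (`|c| + 1) * (e / 2 / (`|c| + 1)).
  by rewrite mulrCA divff ?mulr1// gt_eqF.
by rewrite ler_pM// lerDl.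
Qed.

Lemma unif_cont_suppW n M M' G : M <= M' -> unif_cont_supp n M G ->
  unif_cont_supp n M' G.
Proof.
by move=> MM' [G0 Gc]; split=> // s i ilt sM; apply: (G0 s i) => //; apply: le_lt_trans sM.
Qed.

(** Linearity and the sup bound are kept as predicates in [n]: in dimension [n + 1] each follows
    from continuity of the slices, which in turn uses both in dimension [n]. *)
Let riint_linear n M := forall c G H, unif_cont_supp n M G ->
  unif_cont_supp n M H ->
  riint n (fun s => c * G s + H s) = c * riint n G + riint n H.

Let riint_bounded n M := forall B G, unif_cont_supp n M G ->
  (forall s, `|G s| <= B) -> `|riint n G| <= B * (2 * M) ^+ n.

(** By linearity the difference of two slice integrals is the integral of a difference, which is
    uniformly small for close slices; the sup bound then gives continuity. *)
Let riint_slice n M G : 0 <= M -> riint_linear n M -> riint_bounded n M ->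
  unif_cont_supp n.+1 M G ->
  let J := fun t => riint n (fun s => G (t :: s)) in
  continuous J /\ forall t, M < `|t| -> J t = 0.
Proof.
move=> M0 lin bnd uG /=; split=> t; last first.
  move=> tM; apply/eqP; rewrite -normr_le0 -(mul0r ((2 * M) ^+ n)).
  apply: bnd; first exact: unif_cont_supp_cons.
  by move=> s; rewrite (uG.1 _ 0%N)// normr0.
apply/cvgrPdist_le => e e0.
have P0 : 0 < (2 * M) ^+ n + 1 by rewrite ltr_wpDl// exprn_ge0// mulr_ge0.
have [d d0 Gd] := uG.2 (e / ((2 * M) ^+ n + 1)) ltac:(by rewrite divr_gt0).
near=> t'.
have -> : riint n (fun s => G (t :: s)) - riint n (fun s => G (t' :: s)) =
    riint n (fun s => (-1) * G (t' :: s) + G (t :: s)).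
  by rewrite lin ?mulN1r 1?addrC//; exact: unif_cont_supp_cons.
apply: (@le_trans _ _ (e / ((2 * M) ^+ n + 1) * (2 * M) ^+ n)).
  apply: bnd.
    by apply: unif_cont_supp_lin; exact: unif_cont_supp_cons.
  move=> s; rewrite mulN1r addrC; apply: Gd => -[_|i _] /=; last first.
    by rewrite subrr normr0 ltW.
  by near: t'; apply: cvgr_dist_le => //; exact: cvg_id.
rewrite mulrAC ler_pdivrMr// ler_wpM2l ?(ltW e0)// lerDl//.
Unshelve. all: by end_near. Qed.

Lemma riintP n M : 0 <= M -> riint_linear n M /\ riint_bounded n M.
Proof.
move=> M0; elim: n => [|n [lin bnd]].
  by split=> [c G H _ _//|B G _ /(_ [::])]; rewrite expr0 mulr1.
split=> [c G H uG uH|B G uG GB] /=.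
  have [cG G0] := riint_slice _ _ _ M0 lin bnd uG.
  have [cH H0] := riint_slice _ _ _ M0 lin bnd uH.
  have iG := integrable_compact_support _ _ cG G0.
  have iH := integrable_compact_support _ _ cH H0.
  rewrite -RintegralZl// -RintegralD//; last first.
    by apply: eq_integrable (integrableZl _ c iG).
  apply: eq_Rintegral => t _.
  by rewrite lin//; exact: unif_cont_supp_cons.
have [cG G0] := riint_slice _ _ _ M0 lin bnd uG.
have -> : B * (2 * M) ^+ n.+1 = B * (2 * M) ^+ n * (2 * M).
  by rewrite exprSr; ring.
apply: (normr_Rintegral_le _ _ _ M0 cG G0) => t.
by apply: bnd => //; exact: unif_cont_supp_cons.
Qed.

Lemma riint_lin n M c G H : 0 <= M -> unif_cont_supp n M G ->
  unif_cont_supp n M H ->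
  riint n (fun s => c * G s + H s) = c * riint n G + riint n H.
Proof. by move=> /(riintP n)[lin _]; apply: lin. Qed.

Lemma normr_riint_le n M B G : 0 <= M -> unif_cont_supp n M G ->
  (forall s, `|G s| <= B) -> `|riint n G| <= B * (2 * M) ^+ n.
Proof. by move=> /(riintP n)[_ bnd]; apply: bnd. Qed.

Lemma riint_cons n M G : 0 <= M -> unif_cont_supp n.+1 M G ->
  let J := fun t => riint n (fun s => G (t :: s)) in
  continuous J /\ forall t, M < `|t| -> J t = 0.
Proof. by move=> M0; have [lin bnd] := riintP n _ M0; apply: riint_slice. Qed.

Lemma iintE n M G : 0 <= M -> unif_cont_supp n M G -> (forall s, 0 <= G s) ->
  iint n (fun s => (G s)%:E) = (riint n G)%:E.
Proof.
move=> M0; elim: n G => [//|n IH] G uG G0 /=.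
have [cG GM] := riint_cons _ _ _ M0 uG.
transitivity (\int[mu]_t (riint n (fun s => G (t :: s)))%:E)%E.
  apply: eq_integral => t _.
  by apply: (IH (fun s => G (t :: s))) => //; exact: unif_cont_supp_cons.
rewrite /Rintegral fineK//; apply: integrable_fin_num => //.
exact: integrable_compact_support cG GM.
Qed.

(** A shift of coordinate [0] is a translation of the outermost one-dimensional integral; any other
    coordinate is reached by passing under the outer integrals, so their order is never
    exchanged. *)
Lemma riint_translation n i M G h : 0 <= M -> unif_cont_supp n M G -> (i < n)%N ->
  riint n (fun s => G (set_nth 0 s i (nth 0 s i + h))) = riint n G.
Proof.
move=> M0; elim: n i G => [//|n IH] [|i] G uG ilt /=.
  apply: (Rintegral_translation h (fun t => riint n (fun s => G (t :: s)))).
  by have [] := riint_cons _ _ _ M0 uG.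
apply: eq_Rintegral => t _.
by apply: (IH i (fun s => G (t :: s))) => //; exact: unif_cont_supp_cons.
Qed.

Lemma iint_ge0 n (f : seq R -> \bar R) : (forall s, (0 <= f s)%E) ->
  (0 <= iint n f)%E.
Proof.
elim: n f => [|n IHn] f f0 /=; first exact: f0.
by apply: integral_ge0 => t _; apply: IHn.
Qed.

Lemma iint_cst0 n : iint n (fun=> 0%E : \bar R) = 0%E.
Proof. by elim: n => [//|n IHn] /=; rewrite IHn integral0. Qed.

(** Induction on the layers: the inner integral is at most a constant times the indicator of the
    interval, and [ge0_integral_mono] compares the outer integrals. *)
Lemma iint_le_box n (f : seq R -> \bar R) (x y k : R) : 0 <= k -> x <= y ->
  (forall s, (0 <= f s)%E) -> (forall s, (f s <= k%:E)%E) ->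
  (forall s i, (i < n)%N -> nth 0 s i \notin `[x, y] -> f s = 0%E) ->
  (iint n f <= (k * (y - x) ^+ n)%:E)%E.
Proof.
move=> k0 xy; elim: n f => [|n IH] f f0 fk fs /=; first by rewrite expr0 mulr1.
have K0 : 0 <= k * (y - x) ^+ n by rewrite mulr_ge0// exprn_ge0// subr_ge0.
rewrite exprSr mulrA -integral_cst_itv//.
apply: ge0_integral_mono => t; first exact: iint_ge0.
rewrite indicE; case: (boolP (t \in _)) => [_|txy].
  by rewrite mulr1; apply: (IH (fun s => f (t :: s))) => // s i ilt; exact: (fs (t :: s) i.+1).
have f00 s : f (t :: s) = 0%E.
  by apply: (fs (t :: s) 0%N) => //=; apply: contra txy => txy; apply/mem_set.
have -> : (fun s => f (t :: s)) = (fun=> 0%E) by apply/funext.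
by rewrite iint_cst0 mulr0.
Qed.

Lemma iint_ge_box n (f : seq R -> \bar R) (x y k : R) : 0 <= k -> x <= y ->
  (forall s, (0 <= f s)%E) ->
  (forall s, (forall i, (i < n)%N -> nth 0 s i \in `[x, y]) -> (k%:E <= f s)%E) ->
  ((k * (y - x) ^+ n)%:E <= iint n f)%E.
Proof.
move=> k0 xy; elim: n f => [|n IH] f f0 fk /=; first by rewrite expr0 mulr1 fk.
have K0 : 0 <= k * (y - x) ^+ n by rewrite mulr_ge0// exprn_ge0// subr_ge0.
rewrite exprSr mulrA -integral_cst_itv//.
apply: ge0_integral_mono => t; first by rewrite lee_fin mulr_ge0.
rewrite indicE; case: (boolP (t \in _)) => [/set_mem txy|_]; last first.
  by rewrite mulr0; exact: iint_ge0.
rewrite mulr1; apply: (IH (fun s => f (t :: s))) => // s sxy.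
by apply: fk => -[|i] //= ilt; exact: sxy.
Qed.

End IteratedIntegral.

(** * Functions on row vectors; the integral of a partial derivative *)

Section RowVectors.
Context {R : realType} {N : nat}.
Implicit Types (f w F : 'rV[R]_N -> R) (i : 'I_N) (M : R).

Lemma row_mx_norm_le (x : 'rV[R]_N) d : 0 <= d ->
  (forall i, `|x ord0 i| <= d) -> `|x| <= d.
Proof.
move=> d0 xd; rewrite [leLHS]/Num.norm/= mx_normrE; apply/bigmax_leP; split=> //.
by move=> [i j] _ /=; rewrite ord1.
Qed.

(** Heine-Cantor on the cube [K]. Two points outside [K] both give the value zero; if only one lies
    in [K], the estimate is centred at that one. *)
Lemma unif_cont_supp_row f M : continuous f ->
  (forall (x : 'rV[R]_N) i, M < `|x ord0 i| -> f x = 0) ->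
  unif_cont_supp N M (fun s => f (row_of_seq N s)).
Proof.
move=> fc f0; split=> [s i ilt sM|e e0].
  by apply: (f0 _ (Ordinal ilt)); rewrite mxE.
pose K := [set x : 'rV[R]_N | forall i, `[- M, M]%classic (x ord0 i)].
have cK : compact K.
  by apply: (@rV_compact _ _ (fun=> `[- M, M]%classic)) => i; exact: segment_compact.
have := proj1 (compact_near_coveringP K) cK R (0 : R)^'+
  (fun d x => forall y, `|x - y| <= d -> `|f x - f y| <= e).
move=> /(_ _)[]; last first.
(* The covering property yields radii strictly between 0 and [d], hence the choice [d / 2]. *)
- move=> d /= d0 dK; exists (d / 2); first by rewrite divr_gt0.
  have {}dK x y : K x -> `|x - y| <= d / 2 -> `|f x - f y| <= e.
    move=> Kx xy; apply: (dK (d / 2)) => //=.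
      by rewrite sub0r normrN gtr0_norm ?divr_gt0// ltr_pdivrMr// ltr_pMr// ltr1n.
    by rewrite divr_gt0.
  move=> s s' ss'.
  have rss' : `|row_of_seq N s - row_of_seq N s'| <= d / 2.
    apply: row_mx_norm_le => [|i]; first by rewrite divr_ge0// ltW.
    by rewrite !mxE; exact: ss'.
  have [Ks|Ks] := pselect (K (row_of_seq N s)); first exact: dK.
  have [Ks'|Ks'] := pselect (K (row_of_seq N s')).
    by rewrite distrC; apply: dK => //; rewrite distrC.
  have out x : ~ K x -> f x = 0.
    move=> /existsNP[i xi]; apply: (f0 _ i); rewrite ltNge; apply/negP => xM.
    by apply: xi; rewrite /= in_itv/= -ler_norml.
  by rewrite !out// subrr normr0 ltW.
- move=> x _; have /cvgrPdist_le/(_ (e / 2) ltac:(by rewrite divr_gt0)) := fc x.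
  move=> /nbhs_normP[d /= d0 xd].
  near=> x' d' => /= y xy.
  have x'x : `|x - x'| < d / 2.
    by near: x'; apply: cvgr_dist_lt; [exact: cvg_id|rewrite divr_gt0].
  have d'd : d' <= d / 2.
    by near: d'; apply: nbhs_right_le; rewrite divr_gt0.
  have dd : d / 2 < d by rewrite ltr_pdivrMr// ltr_pMr// ltr1n.
  have fx' : `|f x - f x'| <= e / 2 by apply: xd => /=; exact: lt_trans dd.
  have fy : `|f x - f y| <= e / 2.
    apply: xd => /=; rewrite (splitr d) -(subrK x' x) -addrA.
    by apply: le_lt_trans (ler_normD _ _) _; rewrite ltr_leD// (le_trans xy).
  rewrite -(subrK (f x) (f x')) -addrA (splitr e).
  by apply: le_trans (ler_normD _ _) _; rewrite lerD// distrC.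
Unshelve. all: by end_near. Qed.

(** The positive and negative parts are again continuous with the same support bound, so [iintE]
    applies to each and linearity recombines them. *)
Lemma sintegralNE f M : 0 <= M -> continuous f ->
  (forall (x : 'rV[R]_N) i, M < `|x ord0 i| -> f x = 0) ->
  sintegralN f = (riint N (fun s => f (row_of_seq N s)))%:E.
Proof.
move=> M0 fc f0.
have cN : continuous (fun x => - f x) by move=> x; apply: continuousN; exact: fc.
have cmax (g : 'rV[R]_N -> R) : continuous g -> continuous (fun x => Num.max (g x) 0).
  by move=> gc x; apply: (@continuous_max _ _ g (cst 0)); [exact: gc|exact: cst_continuous].
have u1 : unif_cont_supp N M (fun s => Num.max (f (row_of_seq N s)) 0).
  apply: (@unif_cont_supp_row (fun x => Num.max (f x) 0)); first exact: cmax.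
  by move=> x i xM; rewrite (f0 x i xM) maxxx.
have u2 : unif_cont_supp N M (fun s => Num.max (- f (row_of_seq N s)) 0).
  apply: (@unif_cont_supp_row (fun x => Num.max (- f x) 0)); first exact: cmax.
  by move=> x i xM; rewrite (f0 x i xM) oppr0 maxxx.
have -> : sintegralN f = ((riint N (fun s => Num.max (f (row_of_seq N s)) 0))%:E -
    (riint N (fun s => Num.max (- f (row_of_seq N s)) 0))%:E)%E.
  by congr (_ - _)%E; rewrite -(iintE _ _ _ M0)// => s; rewrite le_max lexx orbT.
rewrite -EFinB; congr EFin; rewrite addrC -mulN1r -(riint_lin _ _ _ _ _ M0 u2 u1).
congr riint; apply/funext => s /=.
by rewrite mulN1r; case: (leP (f _) 0) => ?; case: (leP (- f _) 0) => ?; lra.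
Qed.

Lemma borel_fun_continuous f : continuous f -> borel_fun f.
Proof.
move=> /continuousP fc B mB.
have mf : measurable_fun (setT : set (g_sigma_algebraType (@open 'rV[R]_N))) f.
  apply: (measurability _ (RGenOpens.measurableE R)).
  move=> _ [_ [a [b ->]] <-]; rewrite setTI; apply: sub_sigma_algebra.
  by apply: fc; exact: interval_open.
by have := mf measurableT B mB; rewrite setTI.
Qed.

(** The two difference quotients agree as functions of the increment. This brings directional
    derivatives within reach of the one-variable mean value theorem. *)
Lemma is_derive_line f (x v : 'rV[R]_N) (t d : R) :
  is_derive (t *: v + x) v f d -> is_derive t 1 (fun t => f (t *: v + x)) d.
Proof.
have E : (fun h : R =>
      h^-1 *: (((fun t => f (t *: v + x)) \o shift t) (h *: 1) - f (t *: v + x))) =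
    (fun h => h^-1 *: ((f \o shift (t *: v + x)) (h *: v) - f (t *: v + x))).
  apply/funext => h /=; congr (_ *: (f _ - _)).
  by rewrite [h *: 1]mulr1 scalerDl addrA.
by case=> df Df; split; rewrite /derivable /derive E.
Qed.

Lemma row_of_seq_set_nth (s : seq R) i (h : R) :
  row_of_seq N (set_nth 0 s i (nth 0 s i + h)) =
  h *: ebasis R i + row_of_seq N s.
Proof.
apply/rowP => j; rewrite !mxE nth_set_nth/= val_eqE.
by case: eqP => [->|_]; rewrite ?mulr1 ?mulr0 ?add0r// addrC.
Qed.

(* Translating by h in the i-th coordinate does not change the integral of w, and
   (w (x + h e_i) - w x) / h tends to F uniformly. *)
Lemma riint_derive_eq0 w F i M : 0 <= M -> continuous w -> continuous F ->
  (forall (x : 'rV[R]_N) j, M < `|x ord0 j| -> w x = 0) ->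
  (forall (x : 'rV[R]_N) j, M < `|x ord0 j| -> F x = 0) ->
  (forall x, is_derive x (ebasis R i) w (F x)) ->
  riint N (fun s => F (row_of_seq N s)) = 0.
Proof.
move=> M0 cw cF w0 F0 dw.
pose W s := w (row_of_seq N s); pose G s := F (row_of_seq N s).
have uW : unif_cont_supp N M W by apply: unif_cont_supp_row.
have uG : unif_cont_supp N M G by apply: unif_cont_supp_row.
(* A shift by [h <= 1] may leave the cube of half-width [M], but not that of half-width [M + 1]. *)
have M10 : 0 <= M + 1 by rewrite addr_ge0.
have MM1 : M <= M + 1 by rewrite lerDl.
have uW1 := unif_cont_suppW _ _ _ _ MM1 uW.
have uG1 := unif_cont_suppW _ _ _ _ MM1 uG.
set P := (2 * (M + 1)) ^+ N.
have P0 : 0 <= P by rewrite exprn_ge0// mulr_ge0.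
apply/eqP; rewrite -normr_le0; apply/ler_addgt0Pl => e e0; rewrite addr0.
have e'0 : 0 < e / (P + 1) by rewrite divr_gt0// ltr_wpDl.
have [d d0 Gd] := uG.2 _ e'0.
pose h := Num.min d 1.
have h0 : 0 < h by rewrite lt_min d0 ltr01.
have hd : h <= d by rewrite ge_min lexx.
have h1 : h <= 1 by rewrite ge_min lexx orbT.
pose T s := set_nth 0 s i (nth 0 s i + h).
have uWT : unif_cont_supp N (M + 1) (fun s => W (T s)).
  have -> : (fun s => W (T s)) =
      (fun s => (fun x => w (h *: ebasis R i + x)) (row_of_seq N s)).
    by apply/funext => s; rewrite /W row_of_seq_set_nth.
  apply: (unif_cont_supp_row (fun x => w (h *: ebasis R i + x))).
    move=> x; apply: continuous_comp; last exact: cw.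
    by apply: continuousD; [exact: cst_continuous|exact: cvg_id].
  move=> x j xj; apply: (w0 _ j); rewrite !mxE.
  have : `|x ord0 j| <= `|h * ((ord0 == ord0 :> 'I_1) && (j == i))%:R + x ord0 j| + h.
    rewrite -{1}(addKr (h * ((ord0 == ord0 :> 'I_1) && (j == i))%:R) (x ord0 j)) addrC.
    apply: le_trans (ler_normB _ _) _; rewrite lerD2l normrM gtr0_norm//.
    by rewrite ler_piMr ?(ltW h0)//; case: (_ && _); rewrite ?normr1 ?normr0.
  by move: xj h1; lra.
(* The two [W] terms cancel under the integral by translation invariance, leaving [- h] times the
   integral of [G]. A pointwise bound [h * (e / (P + 1))] suffices, as the volume factor is [P]. *)
have := normr_riint_le N (M + 1) (h * (e / (P + 1)))
  (fun s => (- h) * G s + (- 1 * W s + W (T s))) M10.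
have u1 : unif_cont_supp N (M + 1) (fun s => - 1 * W s + W (T s)).
  exact: unif_cont_supp_lin.
have -> : riint N (fun s => - h * G s + (- 1 * W s + W (T s))) = - h * riint N G.
  rewrite (riint_lin _ _ _ _ _ M10 uG1 u1) (riint_lin _ _ _ _ _ M10 uW1 uWT).
  by rewrite (riint_translation _ _ _ _ _ M10 uW1)// mulN1r addNr addr0.
rewrite normrM normrN (gtr0_norm h0) -mulrA ler_pM2l//.
move=> H; apply: le_trans (H _ _) _.
- exact: unif_cont_supp_lin.
- move=> s; pose x := row_of_seq N s.
  have dx (t : R) : is_derive t (1 : R) (fun t : R => w (t *: ebasis R i + x))
      (F (t *: ebasis R i + x)).
    exact: is_derive_line.
  (* The increment of [w] is [h] times [F] at a point within [h <= d] of [x], so uniform continuity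
     of [F] applies. *)
  have [|c] := @MVT R (fun t : R => w (t *: ebasis R i + x))
      (fun t : R => F (t *: ebasis R i + x)) 0 h h0 (fun t _ => dx t).
    apply: continuous_subspaceT => t; apply: differentiable_continuous.
    by apply/derivable1_diffP; case: (dx t).
  rewrite in_itv/= => /andP[c0 ch]; rewrite scale0r add0r subr0 => wE.
  have -> : - h * G s + (- 1 * W s + W (T s)) = (F (c *: ebasis R i + x) - F x) * h.
    by rewrite /W row_of_seq_set_nth -/x /G -/x; move: wE; lra.
  rewrite normrM (gtr0_norm h0) mulrC ler_pM2l// -row_of_seq_set_nth.
  apply: Gd => j jN; rewrite nth_set_nth/=; case: eqP => [->|_].
    by rewrite addrC addKr gtr0_norm//; lra.
  by rewrite subrr normr0 ltW.
- by rewrite mulrAC ler_pdivrMr ?ltr_wpDl// ler_wpM2l ?(ltW e0)// lerDl.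
Qed.

End RowVectors.

(** * A continuously differentiable bump on the line *)

Section Bump.
Context {R : realType}.
Implicit Types (y z t : R).

(** For piecewise polynomials a quadratic remainder bound can be checked case by case, kinks
    included. *)
Lemma is_derive_quadratic (f : R -> R) y d :
  (forall h, `|f (h + y) - f y - h * d| <= h ^+ 2) -> is_derive y (1 : R) f d.
Proof.
move=> fd.
have cv : (fun h : R => h^-1 *: ((f \o shift y) (h *: (1 : R)) - f y)) @ 0^' --> d.
  apply/cvgrPdist_le => e e0; near=> h.
  have h0 : h != 0 by near: h; exact: nbhs_dnbhs_neq.
  have he : `|h| <= e.
    have : `|(0 : R) - h| <= e.
      by near: h; apply: cvgr_dist_le => //; exact: cvg_within_filter.
    by rewrite sub0r normrN.
  apply: le_trans he => /=; rewrite [h *: 1]mulr1.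
  have -> : d - h^-1 *: (f (h + y) - f y) = - (h^-1 * (f (h + y) - f y - h * d)).
    by rewrite [in LHS]/GRing.scale/=; field.
  rewrite normrN normrM normfV ler_pdivrMl ?normr_gt0// -normrM -expr2.
  by rewrite (le_trans (fd h))// normrX real_normK// num_real.
split; first exact: cvgP cv.
exact: cvg_lim cv.
Unshelve. all: by end_near. Qed.

(** Squaring the positive part makes the derivative continuous at the endpoints of the support
    [-1, 1]. *)
Definition bump z : R := Num.max (1 - z ^+ 2) 0 ^+ 2.
Definition dbump z : R := - 4 * z * Num.max (1 - z ^+ 2) 0.

Lemma is_derive_bump z : is_derive z (1 : R) bump (dbump z).
Proof.
(* The squared positive part has remainder at most [h ^+ 2] whatever the signs of [y] and
   [h + y]. *)
have dsq y : is_derive y (1 : R) (fun y => Num.max y 0 ^+ 2) (2 * Num.max y 0).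
  apply: is_derive_quadratic => h; rewrite ler_norml.
  by case: (leP (h + y) 0) => hy; case: (leP y 0) => y0; apply/andP; split; nra.
have dq : is_derive z (1 : R) (fun z => 1 - z ^+ 2) (- (2 * z)).
  apply: is_derive_quadratic => h.
  have -> : 1 - (h + z) ^+ 2 - (1 - z ^+ 2) - h * - (2 * z) = - (h ^+ 2) by ring.
  by rewrite normrN ger0_norm// sqr_ge0.
have -> : dbump z = 2 * Num.max (1 - z ^+ 2) 0 * - (2 * z) by rewrite /dbump; ring.
exact: (@is_derive1_comp R (fun y => Num.max y 0 ^+ 2) (fun z => 1 - z ^+ 2) z
  _ _ (dsq (1 - z ^+ 2)) dq).
Qed.

Lemma bump_eq0 z : 1 <= `|z| -> bump z = 0 /\ dbump z = 0.
Proof.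
move=> z1; rewrite /bump /dbump max_r ?expr0n ?mulr0//.
by rewrite subr_le0 -real_normK ?num_real// expr_ge1.
Qed.

Lemma bump_ge0 z : 0 <= bump z. Proof. exact: sqr_ge0. Qed.

Lemma bump_le1 z : bump z <= 1.
Proof.
rewrite /bump expr_le1 ?le_max ?lexx ?orbT// ge_max ler01 andbT gerBl.
exact: sqr_ge0.
Qed.

Lemma bump_ge_half z : `|z| <= 1 / 2 -> 1 / 2 <= bump z.
Proof.
rewrite ler_norml => /andP[? ?]; rewrite /bump.
(* Squaring gives 9/16, which exceeds 1/2. *)
have w : 3 / 4 <= 1 - z ^+ 2 by nra.
rewrite max_l; last by lra.
by move: w; set y := 1 - _ => w; nra.
Qed.

Lemma normr_dbump_le z : `|dbump z| <= 4.
Proof.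
have [z1|z1] := leP 1 `|z|; first by rewrite (bump_eq0 z z1).2 normr0.
rewrite /dbump -mulrA normrM normrN normr_nat -[leRHS]mulr1 ler_pM2l//.
rewrite normrM; apply: mulr_ile1 => //; first exact: ltW.
have w0 : 0 <= Num.max (1 - z ^+ 2) 0 by rewrite le_max lexx orbT.
by rewrite ger0_norm// ge_max ler01 andbT gerBl sqr_ge0.
Qed.

End Bump.

Lemma continuous_mulr {R : realType} (T : topologicalType) (f g : T -> R) :
  continuous f -> continuous g -> continuous (fun x => f x * g x).
Proof. by move=> fc gc x; exact: (continuousM (fc x) (gc x)). Qed.

(** * Product bumps and their gradients *)

Section ProductBump.
Context {R : realType} (N : nat) (m rho : R).
Hypothesis rho0 : 0 < rho.
Implicit Types (x : 'rV[R]_N) (i j : 'I_N).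

Definition eta (t : R) := bump ((t - m) / rho).
Definition deta (t : R) := dbump ((t - m) / rho) / rho.
Definition pbump x : R := \prod_(i < N) eta (x ord0 i).
Definition dpbump x : 'rV[R]_N :=
  \row_i (deta (x ord0 i) * \prod_(j < N | j != i) eta (x ord0 j)).

Let is_derive_eta t : is_derive t (1 : R) eta (deta t).
Proof.
have da : is_derive t (1 : R) (fun t => (t - m) / rho) (rho^-1).
  apply: is_derive_quadratic => h.
  have -> : (h + t - m) / rho - (t - m) / rho - h / rho = 0 by ring.
  by rewrite normr0 sqr_ge0.
exact: (@is_derive1_comp R bump (fun t => (t - m) / rho) t _ _ (is_derive_bump _) da).
Qed.

(** Along [ebasis R i] only the factor of index [i] varies; the others form the constant [P], and
    the one-variable chain rule applies. *)
Lemma is_derive_pbump x i : is_derive x (ebasis R i) pbump (dpbump x ord0 i).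
Proof.
set P := \prod_(j < N | j != i) eta (x ord0 j).
have d1 : is_derive (0 : R) (1 : R) (fun t => P * eta (t + x ord0 i))
    (P * deta (x ord0 i)).
  have d2 : is_derive (0 : R) (1 : R) (fun t => eta (t + x ord0 i)) (deta (x ord0 i)).
    have ds : is_derive (0 : R) (1 : R) (fun t => t + x ord0 i) 1.
      by rewrite -[X in is_derive _ _ _ X]addr0; apply: is_deriveD.
    have := @is_derive1_comp R eta (fun t => t + x ord0 i) 0 _ _ (is_derive_eta _) ds.
    by rewrite add0r mulr1.
  have := is_deriveZ P d2; apply.
have E (t : R) : pbump (t *: ebasis R i + x) = P * eta (t + x ord0 i).
  rewrite /pbump (bigD1 i)//= mulrC; congr (_ * _).
    apply: eq_bigr => j ji; rewrite !mxE (negPf ji) andbF mulr0 add0r//.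
  by rewrite !mxE !eqxx mulr1.
rewrite mxE mulrC -/P.
have F : (fun h : R => h^-1 *: ((pbump \o shift x) (h *: ebasis R i) - pbump x)) =
    (fun h : R => h^-1 *: (((fun t => P * eta (t + x ord0 i)) \o shift 0) (h *: 1)
       - P * eta (0 + x ord0 i))).
  apply/funext => h /=; rewrite E -(E 0) scale0r add0r.
  by rewrite [h *: 1]mulr1 addr0.
by case: d1 => d1 D1; split; rewrite /derivable /derive F.
Qed.

Let continuous_coord (f : R -> R) i : continuous f ->
  continuous (fun x => f (x ord0 i)).
Proof.
by move=> fc x; apply: continuous_comp; [exact: coord_continuous|exact: fc].
Qed.

Let derive_continuous (f : R -> R) (df : R -> R) :
  (forall t, is_derive t (1 : R) f (df t)) -> continuous f.
Proof.
move=> d t; apply: differentiable_continuous; apply/derivable1_diffP.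
by case: (d t).
Qed.

Let continuous_eta : continuous eta.
Proof. exact: derive_continuous is_derive_eta. Qed.

Let continuous_deta : continuous deta.
Proof.
have ca : continuous (fun t => (t - m) / rho).
  apply: (@continuous_mulr R R (fun t => t - m) (cst rho^-1)); last exact: cst_continuous.
  by move=> t; apply: continuousB; [exact: cvg_id|exact: cst_continuous].
have cb : continuous (@dbump R).
  apply: (@continuous_mulr R R (fun z => - 4 * z) (fun z => Num.max (1 - z ^+ 2) 0)).
    apply: (@continuous_mulr R R (cst (- 4)) id); first exact: cst_continuous.
    by move=> z; exact: cvg_id.
  move=> z; apply: (@continuous_max _ _ (fun z : R => 1 - z ^+ 2) (cst 0)).
    by apply: continuousB; [exact: cst_continuous|exact: exprn_continuous].
  exact: cst_continuous.
apply: (@continuous_mulr R R (fun t => dbump ((t - m) / rho)) (cst rho^-1)).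
  by move=> t; exact: (continuous_comp (ca t) (cb _)).
exact: cst_continuous.
Qed.

(** A general predicate [P] covers the full product and the products with one factor omitted that
    occur in the gradient. *)
Let continuous_prod_eta (P : pred 'I_N) :
  continuous (fun x => \prod_(j < N | P j) eta (x ord0 j)).
Proof.
rewrite /index_enum; elim: (Finite.enum _) => [|j s IH].
  by under eq_fun do rewrite big_nil; exact: cst_continuous.
under eq_fun do rewrite big_cons; case: (P j) => //.
by apply: continuous_mulr; [apply: continuous_coord; exact: continuous_eta|exact: IH].
Qed.

Lemma continuous_pbump : continuous pbump.
Proof. exact: continuous_prod_eta. Qed.

Lemma continuous_dpbump i : continuous (fun x => dpbump x ord0 i).
Proof.
under eq_fun do rewrite mxE; apply: continuous_mulr.
  by apply: continuous_coord; exact: continuous_deta.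
exact: continuous_prod_eta.
Qed.

Let eta_eq0 t : rho <= `|t - m| -> eta t = 0 /\ deta t = 0.
Proof.
move=> h; have : 1 <= `|(t - m) / rho|.
  by rewrite normrM normfV (gtr0_norm rho0) ler_pdivlMr// mul1r.
by move=> /bump_eq0[e d]; rewrite /eta /deta e d mul0r.
Qed.

Lemma pbump_eq0 x j : rho <= `|x ord0 j - m| -> pbump x = 0 /\ dpbump x = 0.
Proof.
move=> /eta_eq0[e d]; split; first by rewrite /pbump (bigD1 j)//= e mul0r.
apply/rowP => i; rewrite !mxE; have [->|ij] := eqVneq i j; first by rewrite d mul0r.
by rewrite (bigD1 j) 1?eq_sym//= e mul0r mulr0.
Qed.

Let prod_eta_itv (P : pred 'I_N) x :
  0 <= \prod_(j < N | P j) eta (x ord0 j) <= 1.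
Proof.
apply/andP; split; first by apply: prodr_ge0 => j _; exact: bump_ge0.
by apply: prodr_ile1 => j _; rewrite bump_ge0 bump_le1.
Qed.

Lemma pbump_ge0 x : 0 <= pbump x.
Proof. by have /andP[] := prod_eta_itv predT x. Qed.

Lemma pbump_le1 x : pbump x <= 1.
Proof. by have /andP[] := prod_eta_itv predT x. Qed.

Lemma pbump_ge x : (forall j, `|x ord0 j - m| <= rho / 2) -> (1 / 2) ^+ N <= pbump x.
Proof.
move=> xm; rewrite -[N in _ ^+ N]card_ord -prodr_const; apply: ler_prod => j _.
rewrite divr_ge0//=; apply: bump_ge_half.
by rewrite normrM normfV (gtr0_norm rho0) ler_pdivrMr// mulrC mulrA mulr1.
Qed.

Lemma normr_dpbump_le x i : `|dpbump x ord0 i| <= 4 / rho.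
Proof.
rewrite mxE normrM -[leRHS]mulr1; have /andP[p0 p1] := prod_eta_itv (fun j => j != i) x.
rewrite ler_pM// ?(ger0_norm p0)//.
rewrite normrM normfV (gtr0_norm rho0) ler_pM2r ?invr_gt0//.
exact: normr_dbump_le.
Qed.

End ProductBump.

(** * Weak gradients of smooth functions and weighted integrals over small cubes *)

Section Estimates.
Context {R : realType} {N : nat}.
Implicit Types (x : 'rV[R]_N) (i : 'I_N).

Lemma coord_le_enorm x i : `|x ord0 i| <= enorm x.
Proof.
rewrite -sqrtr_sqr ler_wsqrtr// (bigD1 i)//= lerDl.
by apply: sumr_ge0 => j _; exact: sqr_ge0.
Qed.

(** The constant N replaces the sharp square root of N, via N <= N^2; only growth rates matter
    later. *)
Lemma enorm_le x (k : R) : 0 <= k -> (forall i, `|x ord0 i| <= k) ->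
  enorm x <= N%:R * k.
Proof.
move=> k0 xk; have Nk0 : 0 <= N%:R * k by rewrite mulr_ge0.
rewrite -[leRHS]ger0_norm// -sqrtr_sqr ler_wsqrtr//.
apply: (@le_trans _ _ (\sum_(i < N) k ^+ 2)).
  apply: ler_sum => i _; rewrite -real_normK ?num_real//.
  by rewrite lerXn2r// nnegrE.
rewrite sumr_const card_ord -[leLHS]mulr_natl exprMn ler_wpM2r ?sqr_ge0//.
by rewrite -natrX ler_nat; case: (N) => // n; rewrite expnS leq_pmulr// expn1.
Qed.

Lemma L1loc_bounded (f : 'rV[R]_N -> R) (k : R) : continuous f ->
  (forall x, `|f x| <= k) -> L1loc f.
Proof.
move=> fc fk; split; first exact: borel_fun_continuous.
move=> eps rho e0 er; have r0 : 0 < rho by exact: lt_trans er.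
have k0 : 0 <= k by apply: le_trans (fk 0).
apply: (@le_lt_trans _ _ (k * (rho - - rho) ^+ N)%:E); last exact: ltry.
apply: iint_le_box => //; first by lra.
- by move=> s; rewrite lee_fin mulr_ge0//; case: ifP.
- move=> s; rewrite lee_fin; case: ifP => _; first by rewrite mul1r.
  by rewrite mul0r.
- move=> s i iN si; case: ifP => [/andP[_ sr]|_]; last by rewrite mul0r.
  move: si; rewrite in_itv/= -ler_norml => /negP[].
  have := coord_le_enorm (row_of_seq N s) (Ordinal iN).
  by rewrite mxE => /le_trans; apply.
Qed.

(** Integration by parts: the partial derivative of [u * phi] is continuous and supported in the
    cube where [u] and [g] live, so [riint_derive_eq0] makes its integral zero. *)
Lemma weak_grad_C1 (u : 'rV[R]_N -> R) (g : 'rV[R]_N -> 'rV[R]_N) (M k : R) :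
  0 <= M -> continuous u -> (forall i, continuous (fun x => g x ord0 i)) ->
  (forall x i, is_derive x (ebasis R i) u (g x ord0 i)) ->
  (forall x j, M < `|x ord0 j| -> u x = 0 /\ g x = 0) ->
  (forall x, `|u x| <= k) -> (forall x i, `|g x ord0 i| <= k) ->
  weak_grad u g.
Proof.
move=> M0 cu cg du ug0 uk gk; split; first exact: L1loc_bounded cu uk.
split=> [i|phi [smooth _] i]; first exact: L1loc_bounded (cg i) (gk ^~ i).
have [cphi dphi] := smooth [::]; have [cdphi _] := smooth [:: i].
have c1 : continuous (fun x => u x * Dpart [:: i] phi x) by apply: continuous_mulr.
have c2 : continuous (fun x => g x ord0 i * phi x) by apply: continuous_mulr.
have z1 x j : M < `|x ord0 j| -> u x * Dpart [:: i] phi x = 0.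
  by move=> /ug0[-> _]; rewrite mul0r.
have z2 x j : M < `|x ord0 j| -> g x ord0 i * phi x = 0.
  by move=> /ug0[_ ->]; rewrite mxE mul0r.
rewrite (sintegralNE _ _ M0 c1 z1) (sintegralNE _ _ M0 c2 z2) -EFinN; congr EFin.
apply/eqP; rewrite eq_sym -subr_eq0 -opprD oppr_eq0 addrC -[X in X + _]mul1r.
rewrite -(riint_lin _ _ _ _ _ M0); last 2 first.
- exact: (unif_cont_supp_row _ _ c1 z1).
- exact: (unif_cont_supp_row _ _ c2 z2).
apply/eqP.
(* The factor [1] comes from the shape [c * G s + H s] of [riint_lin]. *)
apply: (riint_derive_eq0 (fun x => u x * phi x)
  (fun x => 1 * (u x * Dpart [:: i] phi x) + g x ord0 i * phi x) i _ M0).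
- exact: continuous_mulr.
- have c3 : continuous (fun x => 1 * (u x * Dpart [:: i] phi x)).
    by apply: (continuous_mulr _ (cst 1)) => //; exact: cst_continuous.
  by move=> x; exact: (continuousD (c3 x) (c2 x)).
- by move=> x j /ug0[-> _]; rewrite mul0r.
- by move=> x j xM; rewrite (z1 x j)// (z2 x j)// mulr0 addr0.
- move=> x; have d2 : is_derive x (ebasis R i) phi ('D_(ebasis R i) phi x).
    by apply: DeriveDef => //; exact: dphi.
  have -> : 1 * (u x * Dpart [:: i] phi x) + g x ord0 i * phi x =
      u x *: 'D_(ebasis R i) phi x + phi x *: g x ord0 i.
    by rewrite mul1r; congr (_ + _); exact: mulrC.
  exact: (is_deriveM (du x i) d2).
Qed.

Hypothesis N0 : (0 < N)%N.

(** With m = [expR tau], the coordinates stay within m/2 of m, so m/2 <= [enorm x] <= 2Nm. In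
    logarithms, ln([enorm x]) is within [L] of [tau], and multiplying by [d] treats both signs of
    the exponent at once. *)
Lemma weight_bounds (d : R) : exists2 k : R, 0 < k & forall (tau sigma : R) x,
  sigma <= tau - 1 -> (forall i, `|x ord0 i - expR tau| <= expR sigma) ->
  k^-1 * expR (d * tau) <= enorm x `^ d <= k * expR (d * tau).
Proof.
have N1 : (1 : R) <= N%:R by rewrite ler1n.
pose L : R := ln 2 + ln (2 * N%:R).
exists (expR (`|d| * L)) => [|tau sigma x st xm]; first exact: expR_gt0.
have t0 := expR_gt0 tau.
(* Dividing by e at least halves, since e >= 2. *)
have st2 : expR sigma <= expR tau / 2.
  apply: (@le_trans _ _ (expR (tau - 1))); first by rewrite ler_expR.
  rewrite expRD expRN ler_pM2l// lef_pV2 ?posrE ?expR_gt0//.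
  by have := expR_ge1Dx (1 : R); lra.
have lo : expR tau / 2 <= enorm x.
  apply: le_trans (coord_le_enorm x (Ordinal N0)); apply: le_trans (ler_norm _).
  by have := xm (Ordinal N0); rewrite ler_norml => /andP[]; lra.
have hi : enorm x <= 2 * N%:R * expR tau.
  rewrite -mulrA mulrCA; apply: enorm_le => [|i]; first by rewrite mulr_ge0// ltW.
  by have := xm i; rewrite !ler_norml => /andP[? ?]; apply/andP; split; lra.
have e0 : 0 < enorm x by apply: lt_le_trans lo; rewrite divr_gt0.
pose y := ln (enorm x) - tau.
have yL : `|y| <= L.
  have y1 : - ln 2 <= y.
    rewrite /y lerBrDr addrC -[X in X - _](@expRK R) -ln_div ?posrE//.
    by rewrite ler_ln ?posrE ?divr_gt0.
  have y2 : y <= ln (2 * N%:R).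
    rewrite /y lerBlDr -[X in _ + X](@expRK R) -lnM ?posrE//; last by lra.
    by rewrite ler_ln// posrE; apply: lt_le_trans hi.
  have l2 : 0 <= ln 2 :> R by rewrite ln_ge0// ler1n.
  have l2N : 0 <= ln (2 * N%:R) :> R by rewrite ln_ge0//; lra.
  by rewrite ler_norml /L; apply/andP; split; lra.
rewrite /powR gt_eqF// -expRN -!expRD !ler_expR.
have -> : ln (enorm x) = y + tau by rewrite /y subrK.
have : `|d * y| <= `|d| * L by rewrite normrM ler_wpM2l.
by rewrite ler_norml => /andP[? ?]; apply/andP; split; lra.
Qed.

(** The constant is uniform in [tau], [sigma], [B] and [f]: the weight costs a factor [k], and the
    cube of side 2 rho contributes the factor 2^N. *)
Lemma wint_le (d s : R) : 0 < s -> exists2 k : R, 0 < k &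
  forall (tau sigma B : R) (f : 'rV[R]_N -> R), sigma <= tau - 1 ->
  (forall x, 0 <= f x <= B) ->
  (forall x i, expR sigma < `|x ord0 i - expR tau| -> f x = 0) ->
  (wint d s f <= (k * B `^ s * expR (d * tau + N%:R * sigma))%:E)%E.
Proof.
move=> s0; have [k k0 bnd] := weight_bounds d.
exists (k * 2 ^+ N) => [|tau sigma B f st fB f0]; first by rewrite mulr_gt0// exprn_gt0.
have B0 : 0 <= B by have /andP[] := fB 0; exact: le_trans.
set m := expR tau; set rho := expR sigma.
have rho0 : 0 < rho by exact: expR_gt0.
have -> : k * 2 ^+ N * B `^ s * expR (d * tau + N%:R * sigma) =
    k * expR (d * tau) * B `^ s * ((m + rho) - (m - rho)) ^+ N.
  have -> : m + rho - (m - rho) = 2 * rho by ring.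
  by rewrite exprMn expRD expRM_natl -/rho; ring.
have K0 : 0 <= k * expR (d * tau) * B `^ s.
  by rewrite !mulr_ge0 ?expR_ge0 ?powR_ge0// ltW.
have in_box t : (t \in `[m - rho, m + rho]) = (`|t - m| <= rho).
  by rewrite in_itv/= ler_distlC; apply/andP/andP => -[? ?]; split; lra.
have out (z : seq R) (i : nat) : (i < N)%N -> rho < `|nth 0 z i - m| ->
    f (row_of_seq N z) = 0.
  by move=> iN zi; apply: (f0 _ (Ordinal iN)); rewrite mxE.
apply: iint_le_box => //; first by lra.
- by move=> z; rewrite lee_fin mulr_ge0// powR_ge0.
- move=> z; rewrite lee_fin.
  have [zin|] := pselect (forall i, `|row_of_seq N z ord0 i - m| <= rho).
    have /andP[_ w] := bnd tau sigma (row_of_seq N z) st zin.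
    have /andP[f1 f2] := fB (row_of_seq N z).
    by apply: ler_pM; rewrite ?powR_ge0// ge0_ler_powR ?nnegrE// ltW.
  (* Here [0 < s] matters: a vanishing value must have a vanishing power. *)
  move=> /existsNP[i /negP]; rewrite -ltNge => /f0 ->.
  by rewrite powR0 ?mulr0// gt_eqF.
- move=> z i iN; rewrite in_box -ltNge => /(out _ _ iN) ->.
  by rewrite powR0 ?mulr0// gt_eqF.
Qed.

(** The cube of half-width rho/2 has side exactly rho, so no power of 2 enters the constant. *)
Lemma wint_ge (d s : R) : 0 < s -> exists2 k : R, 0 < k &
  forall (tau sigma B : R) (f : 'rV[R]_N -> R), sigma <= tau - 1 -> 0 <= B ->
  (forall x, (forall i, `|x ord0 i - expR tau| <= expR sigma / 2) -> B <= f x) ->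
  ((k * B `^ s * expR (d * tau + N%:R * sigma))%:E <= wint d s f)%E.
Proof.
move=> s0; have [k k0 bnd] := weight_bounds d.
exists k^-1 => [|tau sigma B f st B0 fB]; first by rewrite invr_gt0.
set m := expR tau; set rho := expR sigma.
have rho0 : 0 < rho by exact: expR_gt0.
have -> : k^-1 * B `^ s * expR (d * tau + N%:R * sigma) =
    k^-1 * expR (d * tau) * B `^ s * ((m + rho / 2) - (m - rho / 2)) ^+ N.
  have -> : m + rho / 2 - (m - rho / 2) = rho by field.
  by rewrite expRD expRM_natl -/rho; ring.
have K0 : 0 <= k^-1 * expR (d * tau) by rewrite mulr_ge0 ?expR_ge0// invr_ge0 ltW.
have in_box t : (t \in `[m - rho / 2, m + rho / 2]) = (`|t - m| <= rho / 2).
  by rewrite in_itv/= ler_distlC; apply/andP/andP => -[? ?]; split; lra.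
apply: iint_ge_box => //; first by rewrite mulr_ge0// powR_ge0.
- by lra.
- by move=> z; rewrite lee_fin mulr_ge0// powR_ge0.
- move=> z zin; rewrite lee_fin.
  have zin' i : `|row_of_seq N z ord0 i - m| <= rho / 2.
    by rewrite mxE -in_box; exact: zin.
  have r2 : rho / 2 <= rho by lra.
  have /andP[w _] := bnd tau sigma (row_of_seq N z) st (fun i => le_trans (zin' i) r2).
  apply: ler_pM; rewrite ?powR_ge0//.
  have Bf := fB _ zin'.
  by rewrite ge0_ler_powR ?nnegrE ?(ltW s0)// (le_trans B0).
Qed.

End Estimates.

(** * From the embedding to linear inequalities between exponents *)

Section Embedding.
Context {R : realType}.

Lemma poweR_between (x : \bar R) (k s : R) : 0 <= s -> (0 <= x)%E ->
  (x <= k%:E)%E -> exists y, [/\ poweR x s = y%:E, 0 <= y & y <= k `^ s].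
Proof.
move=> s0; case: x => [x| |]// x0 xk; exists (x `^ s).
rewrite poweR_EFin powR_ge0; split=> //; rewrite lee_fin in x0; rewrite lee_fin in xk.
by apply: ge0_ler_powR; rewrite ?nnegrE// (le_trans x0).
Qed.

Lemma wint_ge0 (N : nat) (d s : R) (f : 'rV[R]_N -> R) : (0 <= wint d s f)%E.
Proof. by apply: iint_ge0 => z; rewrite lee_fin mulr_ge0// powR_ge0. Qed.

Lemma mul_expR_powR (k L s : R) : 0 <= k ->
  (k * expR L) `^ s^-1 = k `^ s^-1 * expR (L / s).
Proof. by move=> k0; rewrite powRM ?expR_ge0// -expRM. Qed.

(** The embedding is applied to [pbump] with centre [expR tau] and width [expR sigma]; the constants
    are uniform in both parameters. *)
Lemma cont_embedded_expR (N : nat) (a b c p q r : R) : (0 < N)%N ->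
  1 <= p -> 0 < q -> 0 < r -> cont_embedded N a b q p c r ->
  exists2 C : R, 0 <= C & forall tau sigma, sigma <= tau - 1 ->
    expR ((c * tau + N%:R * sigma) / r) <=
    C * (expR ((a * tau + N%:R * sigma) / q) +
         expR ((b * tau + (N%:R - p) * sigma) / p)).
Proof.
move=> N0 p1 q0 r0 [C emb]; have p0 : 0 < p by exact: lt_le_trans p1.
have [k1 k10 ub] := @wint_le R N N0 a q q0.
have [k2 k20 gb] := @wint_le R N N0 b p p0.
have [k3 k30 lb] := @wint_ge R N N0 c r r0.
(* [4 * N%:R] is the bound on the gradient with 1/rho split off; [(1 / 2) ^+ N] is the lower bound
   of [pbump] on the half-size cube. *)
pose K1 := k1 `^ q^-1; pose K2 := (k2 * (4 * N%:R) `^ p) `^ p^-1.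
pose K3 := (k3 * ((1 / 2) ^+ N) `^ r) `^ r^-1.
have K10 : 0 <= K1 by exact: powR_ge0.
have K20 : 0 <= K2 by exact: powR_ge0.
have K30 : 0 < K3 by rewrite powR_gt0// mulr_gt0// powR_gt0// exprn_gt0.
(* The sign of [C] is unknown, hence the absolute value; [K1 + K2] dominates both coefficients. *)
exists (K3^-1 * (`|C| * (K1 + K2))) => [|tau sigma st].
  by rewrite mulr_ge0// ?invr_ge0 ?(ltW K30)// mulr_ge0// addr_ge0.
set m := expR tau; set rho := expR sigma.
have m0 : 0 < m by exact: expR_gt0.
have rho0 : 0 < rho by exact: expR_gt0.
have n4 : 0 <= 4 / rho by rewrite divr_ge0// ltW.
pose u := pbump N m rho; pose g := dpbump N m rho.
have u1 x : `|u x| <= 1 by rewrite ger0_norm ?pbump_ge0// pbump_le1.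
have ug0 (x : 'rV[R]_N) (i : 'I_N) : rho < `|x ord0 i - m| -> u x = 0 /\ g x = 0.
  by move=> /ltW; exact: pbump_eq0.
have nuP : (wint a q (fun x => `|u x|%R) <=
    (k1 * 1 `^ q * expR (a * tau + N%:R * sigma))%:E)%E.
  apply: ub => // [x|x i /ug0[-> _]]; last by rewrite normr0.
  by rewrite normr_ge0 u1.
have iq0 : 0 <= q^-1 by rewrite invr_ge0 ltW.
have [nu [nuE nu0 nub]] := poweR_between _ _ _ iq0 (wint_ge0 _ _ _ _) nuP.
have g_le (x : 'rV[R]_N) : 0 <= enorm (g x) <= N%:R * (4 / rho).
  by rewrite sqrtr_ge0; apply: enorm_le => // i; exact: normr_dpbump_le.
have enorm0 : enorm (0 : 'rV[R]_N) = 0.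
  by rewrite /enorm big1 ?sqrtr0// => i _; rewrite mxE expr0n.
have ngP : (wint b p (fun x => enorm (g x)) <=
    (k2 * (N%:R * (4 / rho)) `^ p * expR (b * tau + N%:R * sigma))%:E)%E.
  by apply: gb => // x i /ug0[_ ->].
have ip0 : 0 <= p^-1 by rewrite invr_ge0 ltW.
have [ng [ngE ng0 ngb]] := poweR_between _ _ _ ip0 (wint_ge0 _ _ _ _) ngP.
have inWug : inW a b q p u g.
  split; last by split; rewrite /wnorm /wnormv ?nuE ?ngE ltry.
  apply: (weak_grad_C1 _ _ (m + rho) (1 + 4 / rho)) => //.
  - by rewrite addr_ge0// ltW.
  - exact: continuous_pbump.
  - by move=> i; exact: continuous_dpbump.
  - by move=> x i; exact: is_derive_pbump.
  - move=> x j xj; apply: (ug0 x j); have := ler_normD (x ord0 j - m) m.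
    by rewrite subrK (gtr0_norm m0); lra.
  - by move=> x; apply: le_trans (u1 x) _; rewrite lerDl.
  - by move=> x i; apply: le_trans (normr_dpbump_le _ _ _ rho0 x i) _; rewrite lerDr.
have := emb u g inWug; rewrite /wnorm /wnormv nuE ngE -EFinD -EFinM.
have := lb tau sigma ((1 / 2) ^+ N) (fun x => `|u x|) st.
move=> /(_ ltac:(by rewrite exprn_ge0// divr_ge0)) => lbu lec.
have {lec}le1 : K3 * expR ((c * tau + N%:R * sigma) / r) <= C * (nu + ng).
  rewrite -lee_fin; apply: le_trans lec.
  rewrite /K3 -mul_expR_powR; last by rewrite mulr_ge0 ?powR_ge0// ltW.
  rewrite -poweR_EFin; apply: gt0_ler_poweR.
  - by rewrite invr_ge0 ltW.
  - rewrite in_itv/= leey andbT lee_fin mulr_ge0 ?expR_ge0//.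
    by rewrite mulr_ge0 ?powR_ge0// ltW.
  - by rewrite in_itv/= leey andbT wint_ge0.
  - by apply: lbu => x xm; apply: le_trans (ler_norm _); exact: pbump_ge.
have nub' : nu <= K1 * expR ((a * tau + N%:R * sigma) / q).
  by rewrite /K1 -mul_expR_powR ?(ltW k10)//; move: nub; rewrite powR1 mulr1.
have ngb' : ng <= K2 * expR ((b * tau + (N%:R - p) * sigma) / p).
  rewrite /K2 -mul_expR_powR; last by rewrite mulr_ge0 ?powR_ge0// ltW.
  move: ngb; congr (_ <= _ `^ _).
  (* Raised to the power [p], the factor 1/rho turns [N%:R * sigma] into [(N%:R - p) * sigma]. *)
  have -> : N%:R * (4 / rho) = 4 * N%:R * expR (- sigma) by rewrite expRN; ring.
  rewrite powRM ?expR_ge0// -expRM -!mulrA -expRD; congr (_ * (_ * expR _)).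
  by ring.
rewrite -mulrA ler_pdivlMl//; apply: (le_trans le1).
set Y := expR _ in nub' *; set Z := expR _ in ngb' *.
have Y0 : 0 <= Y by exact: expR_ge0.
have Z0 : 0 <= Z by exact: expR_ge0.
apply: (@le_trans _ _ (`|C| * (nu + ng))).
  by rewrite ler_wpM2r ?ler_norm// addr_ge0.
rewrite -mulrA ler_wpM2l//; apply: (le_trans (lerD nub' ngb')).
by rewrite mulrDl lerD// ler_wpM2l// ?lerDl ?lerDr.
Qed.

(** If [X] exceeded the maximum [W], then [expR ((X - W) * s)] would stay below the fixed number [D]
    for all [s >= 0]. At [s = D / (X - W)] this contradicts [expR D >= 1 + D]. *)
Lemma expR_dominated (X Y Z x0 y0 z0 C : R) : 0 <= C ->
  (forall s, 0 <= s ->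
    expR (X * s + x0) <= C * (expR (Y * s + y0) + expR (Z * s + z0))) ->
  X <= Num.max Y Z.
Proof.
move=> C0 dom; set W := Num.max Y Z; rewrite leNgt; apply/negP => WX.
have d0 : 0 < X - W by rewrite subr_gt0.
pose D := C * (expR y0 + expR z0) / expR x0.
have D0 : 0 <= D by rewrite divr_ge0 ?expR_ge0// mulr_ge0// addr_ge0// expR_ge0.
have s0 : 0 <= D / (X - W) by rewrite divr_ge0// ltW.
have YW : Y <= W by rewrite le_max lexx.
have ZW : Z <= W by rewrite le_max lexx orbT.
have := dom _ s0; set s := D / (X - W) in s0 *.
have -> : X * s + x0 = (X - W) * s + x0 + W * s by ring.
rewrite 2!expRD => H.
have {H} : expR ((X - W) * s) * expR x0 * expR (W * s) <=
    C * (expR y0 + expR z0) * expR (W * s).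
  apply: (le_trans H); rewrite -mulrA ler_wpM2l// mulrDl.
  rewrite -!expRD !(addrC _ (W * s)).
  by apply: lerD; rewrite ler_expR lerD2r ler_wpM2r.
rewrite ler_pM2r ?expR_gt0// -ler_pdivlMr ?expR_gt0// -/D.
have := expR_ge1Dx ((X - W) * s).
have -> : (X - W) * s = D by rewrite /s mulrC divfK// gt_eqF.
by lra.
Qed.

(** The ray is [tau = alpha * s], [sigma = beta * s - 1]: the shift by 1 ensures [sigma <= tau - 1]
    from [s = 0] on and only produces the constant offsets. *)
Lemma cont_embedded_direction (N : nat) (a b c p q r alpha beta : R) : (0 < N)%N ->
  1 <= p -> 0 < q -> 0 < r -> cont_embedded N a b q p c r -> beta <= alpha ->
  (c * alpha + N%:R * beta) / r <=
  Num.max ((a * alpha + N%:R * beta) / q) ((b * alpha + (N%:R - p) * beta) / p).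
Proof.
move=> N0 p1 q0 r0 emb ba.
have [C C0 dom] := cont_embedded_expR _ _ _ _ _ _ _ N0 p1 q0 r0 emb.
apply: (expR_dominated _ _ _ (- N%:R / r) (- N%:R / q) (- (N%:R - p) / p) C C0).
move=> s s0; have := dom (alpha * s) (beta * s - 1).
have bas : beta * s - 1 <= alpha * s - 1 by rewrite lerD2r ler_wpM2r.
move=> /(_ bas); congr (expR _ <= C * (expR _ + expR _)); by ring.
Qed.

(** The direction [(0, -1)] shrinks the bumps around a fixed centre, so the weights drop out. The
    first alternative of the maximum gives [r <= q], the second the Sobolev bound. *)
Lemma cont_embedded_r_le (N : nat) (a b c p q r : R) : (0 < N)%N ->
  1 <= p -> 0 < q -> 0 < r -> cont_embedded N a b q p c r ->
  r_le_max_pstar_q N p q r.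
Proof.
move=> N0 p1 q0 r0 emb pN; have p0 : 0 < p by exact: lt_le_trans p1.
have := @cont_embedded_direction N a b c p q r 0 (-1) N0 p1 q0 r0 emb ltac:(lra).
have n0 : 0 < N%:R :> R by rewrite ltr0n.
rewrite !mulr0 !add0r !mulrN1 !mulNr !le_max !lerN2 => /orP[|].
  by rewrite ler_pM2l// lef_pV2 ?posrE// => ->; rewrite orbT.
by rewrite ler_pdivlMr// mulrAC ler_pdivrMr// mulrC -ler_pdivlMr ?subr_gt0// => ->.
Qed.

End Embedding.

(** * Reading the conditions on the exponents off suitable directions *)

Theorem theorem2p3 (R : realType) (N : nat) (a b c p q r : R) :
  (1 <= N)%N -> 1 <= p -> 0 < q -> 0 < r ->
  ((a + N%:R) / q != (b - p + N%:R) / p ->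
     cont_embedded N a b q p c r ->
     0 <= theta N a b q p r c <= 1 /\
     theta N a b q p r c * (p^-1 - N%:R^-1 - q^-1) <= r^-1 - q^-1 /\
     r_le_max_pstar_q N p q r) /\
  ((a + N%:R) / q = (b - p + N%:R) / p ->
     c = c0 N a q r ->
     cont_embedded N a b q p c r ->
     r_le_max_pstar_q N p q r).
Proof.
move=> N1 p1 q0 r0; split; last first.
  by move=> _ _ emb; exact: (cont_embedded_r_le _ _ _ _ _ _ _ N1 p1 q0 r0 emb).
move=> AB emb; have rle := cont_embedded_r_le _ _ _ _ _ _ _ N1 p1 q0 r0 emb.
have dir alpha beta := cont_embedded_direction _ _ _ _ _ _ _ alpha beta N1 p1 q0 r0 emb.
have p0 : 0 < p by exact: lt_le_trans p1.
have n0 : 0 < N%:R :> R by rewrite ltr0n.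
have [pn qn rn nn] : [/\ p != 0, q != 0, r != 0 & N%:R != 0 :> R].
  by split; rewrite gt_eqF.
(* These are the scaling exponents of the three norms: c - c^0 = r(G - A) and c^1 - c^0 = r(B - A),
   so theta is the position of [G] between [A] and [B]. *)
pose A := (a + N%:R) / q; pose B := (b - p + N%:R) / p; pose G := (c + N%:R) / r.
have BA0 : B - A != 0 by rewrite subr_eq0 eq_sym.
have thE : theta N a b q p r c = (G - A) / (B - A).
  have -> : theta N a b q p r c = (r * (G - A)) / (r * (B - A)).
    by congr (_ / _); rewrite /c1 /c0 /A /B /G; field; rewrite ?pn ?qn ?rn.
  by rewrite -mulf_div divff// mul1r.
(* Splitting [beta] as [alpha - (alpha - beta)] separates pure scaling from concentration. *)
have dirE alpha beta : beta <= alpha ->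
    G * alpha - N%:R / r * (alpha - beta) <=
    Num.max (A * alpha - N%:R / q * (alpha - beta))
            (B * alpha - (N%:R / p - 1) * (alpha - beta)).
  move=> /dir; congr (_ <= Num.max _ _); rewrite /A /B /G; field.
  - by rewrite rn.
  - by rewrite qn.
  - by rewrite pn.
(* Pure scaling, outward and then inward, puts [G] between the minimum and the maximum of [A] and
   [B]. *)
have up : G <= Num.max A B.
  by have := dirE 1 1 (lexx _); rewrite subrr !mulr0 !subr0 !mulr1.
have lo : - G <= Num.max (- A) (- B).
  by have := dirE (-1) (-1) (lexx _); rewrite subrr !mulr0 !subr0 !mulrN1.
split; [|split=> //]; rewrite thE.
  (* The mixed cases fix the sign of [B - A]; in the other two, [G] equals [A] or [B] and theta is 0
     or 1. *)
  move: up lo; rewrite !le_max !lerN2 => /orP[]up /orP[]lo.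
  - have -> : G - A = 0 by apply/eqP; rewrite subr_eq0 eq_le up.
    by rewrite mul0r lexx ler01.
  - have BA : B - A < 0 by rewrite lt_neqAle BA0/= subr_le0 (le_trans lo).
    by rewrite ler_ndivlMr// ler_ndivrMr// mul0r mul1r lerD2r lo subr_le0 up.
  - have BA : 0 < B - A by rewrite lt_neqAle eq_sym BA0/= subr_ge0 (le_trans lo).
    by rewrite ler_pdivlMr// ler_pdivrMr// mul0r mul1r lerD2r up subr_ge0 lo.
  - have -> : G - A = B - A by congr (_ - _); apply/eqP; rewrite eq_le up.
    by rewrite divff// lexx ler01.
(* The direction in which the two terms on the right-hand side balance. *)
pose t := (N%:R / p - 1 - N%:R / q) / (B - A).
have tBA : t * (B - A) = N%:R / p - 1 - N%:R / q by rewrite /t divfK.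
have := dirE t (t - 1) ltac:(lra).
have -> : t - (t - 1) = 1 by ring.
have -> : B * t - (N%:R / p - 1) * 1 = A * t - N%:R / q * 1.
  by move: tBA; lra.
rewrite maxxx => H.
(* [H] amounts to (G - A)t <= N/r - N/q, which is N times the claim. *)
rewrite -(ler_pM2l n0).
have -> : N%:R * ((G - A) / (B - A) * (p^-1 - N%:R^-1 - q^-1)) = (G - A) * t.
  by rewrite /t; field; rewrite ?pn ?qn ?nn ?BA0.
have -> : N%:R * (r^-1 - q^-1) = N%:R / r - N%:R / q by ring.
by lra.
Qed.
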